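(* Every locally connected compact Hausdorff space $K$ which satisfies c.c.c. also satisfies condition (B); that is, for each $\delta>0$ there is no uncountable $\delta$-$\prec$-chain in $C(K)$.
   Context: $C(K)$ is the Banach space of all scalar-valued (real or complex) continuous functions on $K$ with the supremum norm. The support $\mathrm{supp}(f)$ of $f\in C(K)$ is the closure of $\{x\in K\colon f(x)\neq 0\}$. For $f,g\in C(K)$ write $f\prec g$ if $f\neq g$ and $f(x)=g(x)$ for every $x\in\mathrm{supp}(f)$; this is a strict (partial) ordering on $C(K)$. A $\prec$-chain is a subset of $C(K)$ any two distinct elements of which are comparable under $\prec$. For $\delta>0$, a $\delta$-$\prec$-chain is a $\prec$-chain $F$ with $\sup_{f\in F}\|f\|<\infty$ and $\|f-g\|\geqslant\delta$ for all distinct $f,g\in F$. A compact Hausdorff space $K$ satisfies condition (B) if for each uncountable $\prec$-chain $F$ in $C(K)$ with $\sup_{f\in F}\|f\|<\infty$ one has $\inf\{\|f-g\|\colon f,g\in F,\ f\neq g\}=0$; equivalently, for each $\delta>0$ there is no uncountable $\delta$-$\prec$-chain in $C(K)$. A topological space is locally connected if each point has a neighbourhood basis consisting of connected sets. A topological space satisfies c.c.c. if its cellularity is countable, i.e. every family of pairwise disjoint open sets in it is countable. *)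

(* Defs.v *)
From HB Require Import structures.
From mathcomp Require Import all_boot all_order all_algebra.
From mathcomp Require Import all_classical all_reals.
From mathcomp Require Import topology normedtype.
From mathcomp.real_closed Require Import complex.

Set Implicit Arguments.
Unset Strict Implicit.
Unset Printing Implicit Defensive.

Import Order.TTheory GRing.Theory Num.Theory.
Import numFieldNormedType.Exports.

Local Open Scope classical_set_scope.
Local Open Scope ring_scope.

Variant scalars := RealScalars | ComplexScalars.

Definition scalar_field (R : realType) (k : scalars) : numFieldType :=
  match k with
  | RealScalars => R
  | ComplexScalars => R[i]
  end.

(* The norm `|z| of z : R[i] is itself an element of R[i]; normc z is the
   same modulus as an element of R, where suprema are available. *)
Definition modulus (R : realType) (k : scalars) : scalar_field R k -> R :=
  match k return scalar_field R k -> R with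
  | RealScalars => fun x : R => `|x|
  | ComplexScalars => fun z : R[i] => Normc.normc z
  end.

(* The codomain carries the topology induced by its norm as a numFieldType. *)
Definition CK (R : realType) (k : scalars) (K : topologicalType) :=
  continuousType K (scalar_field R k).

Section CK_theory.
Context {R : realType} {k : scalars} {K : topologicalType}.
Implicit Types (f g : CK R k K) (F : set (CK R k K)).

(* Stated on bare functions because the library puts no algebraic structure on
   continuousType. The value is 0 if K is empty. *)
Definition supnorm (f : K -> scalar_field R k) : R :=
  sup [set modulus (f x) | x in [set: K]].

Definition supp f : set K := closure [set x | f x != 0].

Definition prec f g : Prop := f <> g /\ (forall x, supp f x -> f x = g x).

Definition prec_chain F : Prop :=
  forall f g, F f -> F g -> f <> g -> prec f g \/ prec g f.

Definition norm_bounded F : Prop := has_ubound [set supnorm f | f in F].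

Definition delta_prec_chain (delta : R) F : Prop :=
  [/\ prec_chain F, norm_bounded F &
      forall f g, F f -> F g -> f <> g -> delta <= supnorm (f \- g)].

Definition separations F : set R :=
  [set r | exists f g, [/\ F f, F g, f <> g & r = supnorm (f \- g)]].

End CK_theory.

Definition condition_B (R : realType) (k : scalars) (K : topologicalType) :
    Prop :=
  forall F : set (CK R k K),
    prec_chain F -> norm_bounded F -> ~ countable F -> inf (separations F) = 0.

Definition locally_connected (K : topologicalType) : Prop :=
  forall (x : K) (U : set K), nbhs x U ->
    exists V : set K, [/\ nbhs x V, connected V & V `<=` U].

Definition ccc (K : topologicalType) : Prop :=
  forall D : set (set K), D `<=` open -> trivIset D id -> countable D.

(* Main.v *)
Require Import Defs.
From HB Require Import structures.
From mathcomp Require Import all_boot all_order all_algebra.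
From mathcomp Require Import finmap.
From mathcomp Require Import all_classical all_reals.
From mathcomp Require Import topology normedtype.
From mathcomp.real_closed Require Import complex.

Set Implicit Arguments.
Unset Strict Implicit.
Unset Printing Implicit Defensive.

Import Order.TTheory GRing.Theory Num.Theory.
Import numFieldNormedType.Exports.

Local Open Scope classical_set_scope.
Local Open Scope ring_scope.

(** If [f] precedes [g], then the set where [f] does not vanish is clopen in the
    set where [g] does not vanish, since on the boundary of the former both
    functions are zero. Hence every connected component of the cozero set of
    [f] is a connected component of the cozero set of [g], and [f] and [g]
    agree on it: passing from [f] to [g] only adds new components
    ([prec_component]).

    Fix [c > 0] below the separation [delta] of the chain, and attach to [f]
    the components of its cozero set on which [|f|] reaches [c]. There are only
    finitely many of them: the components are open by local connectedness,
    pairwise disjoint, and they cover the compact set where [|f| >= c]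
    ([finite_peak_components]). Along the order this finite set grows
    ([prec_peak_components_sub]), and strictly so, because [g - f] has norm at
    least [delta > c] and therefore [g] exceeds [c] at a point where [f]
    vanishes ([prec_new_peak_component]).

    The number of attached components is thus a strictly increasing map from
    the chain to the natural numbers. As any two members of the chain are
    comparable, this map is injective and the chain is countable
    ([separated_prec_chain_countable]). The infimum form of condition (B)
    follows by taking the infimum of the separations, if positive, as
    [delta]. *)

(** * Components of open sets *)

Definition meeting_components (T : topologicalType) (U A : set T) :
  set (set T) := [set connected_component U x | x in A].

Lemma open_connected_component (T : topologicalType) (U : set T) (x : T) :
  locally_connected T -> open U -> open (connected_component U x).
Proof.
move=> lcT oU; rewrite openE => y Cxy.
have Uy : U y by exact: connected_component_sub Cxy.
have [V [nyV cV VU]] := lcT y U (open_nbhs_nbhs (conj oU Uy)).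
rewrite (same_connected_component Cxy).
apply: filterS (nyV); apply: connected_component_max => //.
exact: nbhs_singleton nyV.
Qed.

(** The components of [U] are open and each point lies in exactly one, so a
    finite subcover of [A] by components already contains all those that meet
    [A]. *)
Lemma finite_meeting_components (T : topologicalType) (U A : set T) :
  locally_connected T -> open U -> compact A -> A `<=` U ->
  finite_set (meeting_components U A).
Proof.
move=> lcT oU cA AU.
have [->|/set0P[x0 _]] := eqVneq A set0.
  by rewrite /meeting_components image_set0.
(* The covering form of compactness is stated for pointed spaces. *)
pose pT : ptopologicalType := HB.pack (T : Type) T (isPointed.Build T x0).
have : cover_compact (A : set pT) by rewrite -(@compact_cover pT).
case/(_ T A (connected_component U)).
- by move=> x _; exact: open_connected_component.
- by move=> x Ax; exists x => //; apply/connected_component_refl/AU.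
move=> D _ Dcover.
apply: (@sub_finite_set _ _ [set connected_component U x | x in [set` D]]).
  move=> _ [x Ax <-]; have [y Dy Cyx] := Dcover x Ax.
  by exists y => //; exact: same_connected_component.
exact/finite_image/finite_fset.
Qed.

(** The component in [V] of a point of [U] is cut by [U] in a clopen piece, so
    by connectedness it stays inside [U]. *)
Lemma connected_component_clopen (T : topologicalType) (U V : set T) (x : T) :
  open U -> U `<=` V -> V `&` closure U `<=` U -> U x ->
  connected_component U x = connected_component V x.
Proof.
move=> oU UV VclU Ux; have Vx := UV x Ux.
have CV : connected_component V x `<=` V by exact: connected_component_sub.
have CU : connected_component V x `<=` U.
  apply/setIidPl; apply: component_connected.
  - by exists x; split=> //; exact: connected_component_refl.
  - by exists U.
  - exists (closure U); first exact: closed_closure.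
    by apply/seteqP; split=> y [Cy Uy]; split=> //;
      [exact: subset_closure | apply: VclU; split=> //; exact: CV].
apply/seteqP; split; last first.
  apply: connected_component_max => //; last exact: component_connected.
  exact: connected_component_refl.
apply: connected_component_max => //; last exact: component_connected.
  exact: connected_component_refl.
by apply: subset_trans UV; exact: connected_component_sub.
Qed.

(** * The modulus of scalars *)

Section scalars.
Variables (R : realType) (k : scalars).
Implicit Types (c : R) (z : scalar_field R k).

Lemma modulus0 : modulus (0 : scalar_field R k) = 0.
Proof. by case: k; [exact: normr0 | exact: Normc.normc0]. Qed.

Lemma modulus_ge0 z : 0 <= modulus z.
Proof. by case: k z => [x|[a b]]; [exact: normr_ge0 | exact: sqrtr_ge0]. Qed.

(** The modulus takes values in [R], whereas balls of the scalar field have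
    radii in that field; in the complex case the bound is embedded as a complex
    radius. *)
Lemma open_modulus_lt c : open [set z : scalar_field R k | modulus z < c].
Proof.
have [c' ->] : exists c' : scalar_field R k,
    [set z : scalar_field R k | modulus z < c] =
    ball (0 : scalar_field R k) c'.
  case: k => /=.
    by exists c; apply/seteqP; split=> z /=;
      rewrite -ball_normE /= sub0r normrN.
  exists c%:C%C; apply/seteqP; split=> z /=;
    by rewrite -ball_normE /= sub0r normrN -ltcR.
exact: ball_open.
Qed.

End scalars.

(** * Cozero components and peaks along a chain *)

Section peaks.
Variables (R : realType) (k : scalars) (K : topologicalType).
Implicit Types (c delta : R) (f g : CK R k K) (F : set (CK R k K)).

Definition cozero f : set K := [set x | f x != 0].

Definition peak c f : set K := [set x | c <= modulus (f x)].

Definition peak_components c f : set (set K) :=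
  meeting_components (cozero f) (peak c f).

Lemma open_cozero f : open (cozero f).
Proof.
have -> : cozero f = f @^-1` (~` [set 0]).
  by apply/seteqP; split=> x /= /eqP.
apply: open_comp => [x _|]; first exact: cts_fun.
apply: closed_openC; apply: accessible_closed_set1.
by apply: hausdorff_accessible; exact: norm_hausdorff.
Qed.

Lemma closed_peak c f : closed (peak c f).
Proof.
have -> : peak c f = ~` (f @^-1` [set z : scalar_field R k | modulus z < c]).
  by apply/seteqP; split=> x; rewrite /peak /= leNgt => /negP.
apply: open_closedC; apply: open_comp => [x _|]; first exact: cts_fun.
exact: open_modulus_lt.
Qed.

Lemma peak_sub_cozero c f : 0 < c -> peak c f `<=` cozero f.
Proof.
move=> c0 x; rewrite /peak /cozero /=; apply: contraTneq => ->.
by rewrite modulus0 -ltNge.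
Qed.

Lemma supnorm_ge0 (h : K -> scalar_field R k) : 0 <= supnorm h.
Proof.
rewrite /supnorm; set S := (X in sup X).
have [hS|/sup_out -> //] := pselect (has_sup S).
have [[_ [x _ _]] _] := hS.
apply: le_trans (modulus_ge0 (h x)) _.
by apply: ub_le_sup; [case: hS | exists x].
Qed.

Lemma supnorm_gt c (h : K -> scalar_field R k) :
  0 <= c -> c < supnorm h -> exists x, c < modulus (h x).
Proof.
move=> c0; rewrite /supnorm; set S := (X in sup X) => cS.
have [S0|/set0P S0] := eqVneq S set0.
  by move: cS; rewrite S0 sup0 ltNge c0.
by have [_ [x _ <-]] := sup_gt S0 cS; exists x.
Qed.

Lemma prec_agree f g x : prec f g -> cozero f x -> f x = g x.
Proof. by move=> [_ fg] fx; apply: fg; exact: subset_closure. Qed.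

Lemma prec_cozero_sub f g : prec f g -> cozero f `<=` cozero g.
Proof. by move=> fg x fx; rewrite /cozero /= -(prec_agree fg). Qed.

(** On the closure of the cozero set of [f] the extension [g] equals [f], so a
    point of that closure where [g] does not vanish is already a point where
    [f] does not vanish: the smaller cozero set is clopen in the larger. *)
Lemma prec_component f g x : prec f g -> cozero f x ->
  connected_component (cozero f) x = connected_component (cozero g) x.
Proof.
move=> fg; apply: connected_component_clopen.
- exact: open_cozero.
- exact: prec_cozero_sub.
- by move=> y [gy fy]; rewrite /cozero /=; case: fg => _ ->.
Qed.

Lemma prec_peak_components_sub c f g : 0 < c -> prec f g ->
  peak_components c f `<=` peak_components c g.
Proof.
move=> c0 fg _ [x px <-]; have fx := peak_sub_cozero c0 px.
exists x; last by rewrite (prec_component fg).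
by move: px; rewrite /peak /= (prec_agree fg fx).
Qed.

(** A point [x] where [g] and [f] differ by more than [c] lies outside the
    support of [f], so [g] itself exceeds [c] there, and the component of [x]
    cannot occur for [f] because [f] vanishes at [x]. *)
Lemma prec_new_peak_component c f g :
  0 < c -> prec f g -> c < supnorm (g \- f) ->
  ~ (peak_components c g `<=` peak_components c f).
Proof.
move=> c0 fg /(supnorm_gt (ltW c0))[x cx] sub.
have f0 : f x = 0.
  apply/eqP; apply: contraT => fx; move: cx.
  by rewrite /= (prec_agree fg fx) subrr modulus0 ltNge (ltW c0).
move: cx; rewrite /= f0 subr0 => /ltW px.
have gx := peak_sub_cozero c0 px.
have [y py yx] : peak_components c f (connected_component (cozero g) x).
  by apply: sub; exists x.
have : connected_component (cozero f) y x.
  by rewrite yx; exact: connected_component_refl.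
by move/connected_component_sub; rewrite /cozero /= f0 eqxx.
Qed.

Lemma finite_peak_components c f :
  compact [set: K] -> locally_connected K -> 0 < c ->
  finite_set (peak_components c f).
Proof.
move=> cK lcK c0; apply: finite_meeting_components => //.
- exact: open_cozero.
- by apply: subclosed_compact cK _ => //; exact: closed_peak.
- exact: peak_sub_cozero.
Qed.

(** The number of components reaching [delta / 2] enumerates the chain. A level
    strictly below [delta] is taken so that a difference of norm at least
    [delta] exceeds it at some point. *)
Lemma separated_prec_chain_countable delta F :
  compact [set: K] -> locally_connected K -> 0 < delta -> prec_chain F ->
  (forall f g, F f -> F g -> f <> g -> delta <= supnorm (f \- g)) ->
  countable F.
Proof.
move=> cK lcK d0 chF sepF; pose c := delta / 2.
have c0 : 0 < c by rewrite divr_gt0.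
have cd : c < delta by rewrite ltr_pdivrMr // mulr_natr mulr2n ltrDl.
pose n f := #|` fset_set (peak_components c f)|%fset.
have fin f : finite_set (peak_components c f) by exact: finite_peak_components.
have n_incr f g : F f -> F g -> prec f g -> (n f < n g)%N.
  move=> Ff Fg fg; apply: fproper_ltn_card; rewrite fproperE.
  apply/andP; split; first by rewrite -fset_set_sub //;
    exact: prec_peak_components_sub.
  apply/negP; rewrite -fset_set_sub //.
  apply: prec_new_peak_component => //.
  apply: (lt_le_trans cd); apply: sepF => // gf.
  by case: fg => + _; rewrite gf.
apply/countable_injP; exists n => f g /set_mem Ff /set_mem Fg nfg.
apply: contrapT => fg.
by have [fg'|gf'] := chF f g Ff Fg fg;
  [have := n_incr f g Ff Fg fg' | have := n_incr g f Fg Ff gf'];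
  rewrite nfg ltnn.
Qed.

End peaks.

Theorem corollary3p5 (R : realType) (k : scalars) (K : topologicalType)
    (K_compact : compact [set: K]) (K_hausdorff : hausdorff_space K)
    (K_locally_connected : locally_connected K) (K_ccc : ccc K) :
  condition_B R k K /\
  (forall delta : R, 0 < delta ->
     ~ exists F : set (CK R k K), delta_prec_chain delta F /\ ~ countable F).
Proof.
split=> [F chF _ uncF|delta d0 [F [[chF _ sepF] uncF]]]; last first.
  exact/uncF/(separated_prec_chain_countable K_compact K_locally_connected d0).
have [->|/set0P sep0] := eqVneq (separations F) set0; first exact: inf0.
have lb0 : lbound (separations F) 0.
  by move=> _ [f [g [_ _ _ ->]]]; exact: supnorm_ge0.
apply/eqP; rewrite eq_le lb_le_inf // andbT leNgt; apply/negP => inf_gt0.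
apply: uncF.
apply: (separated_prec_chain_countable K_compact K_locally_connected
          inf_gt0 chF).
move=> f g Ff Fg fg; apply: ge_inf; first by exists 0.
by exists f, g.
Qed.
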